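(* Let $(X,\mathcal{A})$ be a measurable space. Every ideal in the ring $M(X)$ of real measurable functions on $X$ is a $z$-ideal.
   Context: A measurable space $(X,\mathcal{A})$ is a nonempty set $X$ with a $\sigma$-algebra $\mathcal{A}$ of subsets of $X$. $M(X)$ is the commutative ring (pointwise operations) of all functions $f:X\to\mathbb{R}$ with $f^{-1}(V)\in\mathcal{A}$ for every open $V\subseteq\mathbb{R}$. For a commutative ring $R$ with $1$ and $a\in R$, let $\mathfrak{M}(a)$ be the set of all maximal ideals of $R$ containing $a$. An ideal $I$ of $R$ is a $z$-ideal (à la Mason) if, whenever $a\in I$, $b\in R$ and $\mathfrak{M}(a)\subseteq\mathfrak{M}(b)$, then $b\in I$. *)

(* Defs.v *)
From mathcomp Require Import all_boot all_order all_algebra.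
From mathcomp Require Import all_classical all_reals all_analysis.
From mathcomp Require Import measurable_realfun.

Set Implicit Arguments.
Unset Strict Implicit.
Unset Printing Implicit Defensive.

Import GRing.Theory numFieldNormedType.Exports.

Local Open Scope classical_set_scope.
Local Open Scope ring_scope.

(* Ideals are Prop-valued sets that may be improper, whereas [idealr] of
   [ring_quotient] is boolean-valued and excludes the unit ideal. *)
Definition is_ideal (A : comPzRingType) (I : set A) : Prop :=
  [/\ I 0, (forall x y, I x -> I y -> I (x + y))
    & (forall r x, I x -> I (r * x))].

Definition is_maximal_ideal (A : comPzRingType) (M : set A) : Prop :=
  [/\ is_ideal M, M <> setT
    & forall J : set A, is_ideal J -> M `<=` J -> J = M \/ J = setT].

Definition maximal_ideals_containing (A : comPzRingType) (a : A) :
    set (set A) :=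
  [set M | is_maximal_ideal M /\ M a].

Definition is_z_ideal (A : comPzRingType) (I : set A) : Prop :=
  is_ideal I /\
  forall a b : A, I a ->
    maximal_ideals_containing a `<=` maximal_ideals_containing b -> I b.

(* M(X) is the library's ring [{mfun X >-> R}] of Borel measurable functions;
   Borel measurability amounts to measurability of the preimages of open sets. *)
Lemma measurable_fun_preimage_open (d : measure_display) (X : measurableType d)
    (R : realType) (f : X -> R) :
  measurable_fun [set: X] f <->
  (forall V : set R, open V -> measurable (f @^-1` V)).
Proof.
split=> [mf V oV|mf].
  by rewrite -[X in measurable X]setTI; apply: mf => //; exact: open_measurable.
apply: (measurability _ (RGenOpens.measurableE R)) => _ [_ [a [b ->] <-]].
by rewrite setTI; apply: mf; exact: interval_open.
Qed.

(* Main.v *)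
Require Import Defs.
From mathcomp Require Import all_boot all_order all_algebra.
From mathcomp Require Import all_classical all_reals all_analysis.
From mathcomp Require Import measurable_realfun.

(** Inversion of real numbers, with 0 sent to 0, is Borel measurable, so M(X) is
    von Neumann regular: each a has a quasi-inverse a' with a a' equal to 1
    where a is nonzero and to 0 on the zero set Z(a). If Z(a) is included in
    Z(b), then b = (b a') a ([mfun_dvd_zeros]), so every ideal containing a
    contains b.

    It remains to deduce that Z(a) lies in Z(b) from the inclusion of the maximal
    ideals containing a among those containing b. For this the fixed ideals
    [f | f x = 0] are enough: they are maximal ([fixed_ideal_maximal]), and the
    one at x contains a exactly when x lies in Z(a). *)

Set Implicit Arguments.
Unset Strict Implicit.
Unset Printing Implicit Defensive.

Import GRing.Theory Num.Theory numFieldNormedType.Exports.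

Local Open Scope classical_set_scope.
Local Open Scope ring_scope.

(** The two pieces are the closed set {0}, where the value is 0, and its open
    complement, where inversion is continuous. *)
Lemma measurable_invr (R : realType) :
  measurable_fun [set: R] (GRing.inv : R -> R).
Proof.
have -> : GRing.inv = (fun t : R => if t == 0 then 0 else t^-1).
  by apply/funext => t; case: eqP => // ->; rewrite invr0.
have pre_neq0 : [set: R] `&` (fun t : R => t == 0) @^-1` [set false] =
    [set t | t != 0].
  by rewrite setTI; apply/seteqP; split=> t /=; case: (t == 0).
apply: measurable_fun_if => //.
- exact: measurable_fun_eqr.
- rewrite pre_neq0; apply: open_continuous_measurable_fun.
    exact: open_neq.
  by move=> t /set_mem t0; exact: inv_continuous.
Qed.

Section MeasurableFunctionRing.
Context (d : measure_display) (X : measurableType d) (R : realType).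
Implicit Types (f g a b : {mfun X >-> R}) (x : X).

Lemma measurable_mfun_inv f : measurable_fun [set: X] (fun x => (f x)^-1).
Proof. by apply: measurableT_comp; [exact: measurable_invr|]. Qed.

Definition mfun_inv f : {mfun X >-> R} :=
  mfun_Sub (mem_set (measurable_mfun_inv f)).

Lemma mfun_dvd_zeros a b :
  (forall x, a x = 0 -> b x = 0) -> b = b * mfun_inv a * a.
Proof.
move=> zab; apply/mfuneqP => x.
rewrite -[RHS]/(b x / a x * a x).
have [ax0|ax_neq0] := eqVneq (a x) 0; last by rewrite mulfVK.
by rewrite zab// !mul0r.
Qed.

Definition fixed_ideal x : set {mfun X >-> R} := [set f | f x = 0].

Lemma fixed_ideal_is_ideal x : is_ideal (fixed_ideal x).
Proof.
split=> [//|f g fx0 gx0|r f fx0].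
- by rewrite /fixed_ideal /mkset -[LHS]/(f x + g x) fx0 gx0 addr0.
- by rewrite /fixed_ideal /mkset -[LHS]/(r x * f x) fx0 mulr0.
Qed.

(** If f does not vanish at x, then 1 - f' f does, f' being the quasi-inverse
    of f; hence an ideal containing f and the fixed ideal at x contains 1. *)
Lemma fixed_ideal_maximal x : is_maximal_ideal (fixed_ideal x).
Proof.
split; first exact: fixed_ideal_is_ideal.
  move=> fixT; have : fixed_ideal x 1 by rewrite fixT.
  by move/eqP; rewrite oner_eq0.
move=> J [_ JD JM] fixJ.
have [Jfix|/existsNP[f /not_implyP[Jf /eqP fx_neq0]]] :=
  pselect (J `<=` fixed_ideal x); first by left; apply/seteqP.
right; apply/seteqP; split=> // g _.
suff J1 : J 1 by rewrite -[g]mulr1; exact: JM.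
rewrite -[1](subrK (mfun_inv f * f)); apply: JD; last exact: JM.
apply: fixJ; rewrite /fixed_ideal /mkset -[LHS]/(1 - (f x)^-1 * f x).
by rewrite mulVf ?subrr.
Qed.

End MeasurableFunctionRing.

Theorem proposition9 (d : measure_display) (X : measurableType d)
    (R : realType) (I : set {mfun X >-> R}) :
  is_ideal I -> is_z_ideal I.
Proof.
move=> idI; split=> // a b Ia sub_ab.
have [_ _ IM] := idI.
rewrite (@mfun_dvd_zeros _ _ _ a b); first exact: IM.
move=> x ax0.
by have [] := sub_ab (fixed_ideal x) (conj (fixed_ideal_maximal R x) ax0).
Qed.
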